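(* Let $k$ be a field of characteristic not $2$ or $3$, let $d>1$ be an integer, and let $\Gamma^{E^{(2)}_d}$ be the edge $d$-partition of the complete graph $K_{2d}$ associated with $E^{(2)}_d$. Suppose that the following two statements (a conjecture in general) hold for $d$: (1) there exists a map $\varepsilon^{S^2}_d:\mathcal{P}^{h,cf}_d(K_{2d})\to\{\pm1\}$ such that $\varepsilon^{S^2}_d(\Gamma^{E^{(2)}_d})=(-1)^{d+1}$ and $\varepsilon^{S^2}_d(\Gamma^{(x,y,z)})=-\varepsilon^{S^2}_d(\Gamma)$ for all $\Gamma\in\mathcal{P}^{h,cf}_d(K_{2d})$ and all $1\le x<y<z\le 2d$; (2) the map $det^{S^2}:V_d^{\otimes d(2d-1)}\to k$ determined by $$det^{S^2}(\otimes_{1\leq i<j\leq 2d}(v_{i,j}))=\sum_{\Gamma\in\mathcal{P}^{h,cf}_d(K_{2d})}\varepsilon^{S^2}_d(\Gamma)\,M_{\Gamma}(\otimes_{1\leq i<j\leq 2d}(v_{i,j}))$$ is linear, nontrivial, and satisfies $det^{S^2}(\otimes_{1\leq i<j\leq 2d}(v_{i,j}))=0$ whenever there exist $1\leq x<y<z\leq 2d$ with $v_{x,y}=v_{x,z}=v_{y,z}$. Let $A$ be an $S^2$-Upper Triangular $d\times d(2d-1)$ matrix over $k$, let $\otimes_{1\leq i<j\leq 2d}(v_{i,j})$ be the simple tensor associated with $A$, and write $det^{S^2}(A)=det^{S^2}(\otimes_{1\leq i<j\leq 2d}(v_{i,j}))$. Then $$det^{S^2}(A)=det^{S^2}(E^{(2)}_d)\cdot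 prod(diag^{S^2}(A)).$$
   Context: Let $V_d$ be a $d$-dimensional $k$-vector space with basis $e_1,\dots,e_d$; write $v=\sum_{r=1}^d v^r e_r$ for $v\in V_d$. A $d\times d(2d-1)$ matrix $A$ over $k$ has its columns indexed by pairs $(i,j)$ with $1\le i<j\le 2d$ in dictionary order; if $v_{i,j}$ is the column indexed $(i,j)$, viewed as a vector of $V_d$, then the simple tensor associated with $A$ is $\otimes_{1\le i<j\le 2d}(v_{i,j})\in V_d^{\otimes d(2d-1)}$, and the entry of $A$ in column $(i,j)$ and row $r$ is $v_{i,j}^r$. Edge partitions: an edge $d$-partition of a graph $\Gamma$ is an ordered tuple $(\Gamma_1,\dots,\Gamma_d)$ of subgraphs with $V(\Gamma_r)=V(\Gamma)$ for all $r$, pairwise disjoint edge sets, and $\bigcup_r E(\Gamma_r)=E(\Gamma)$. It is cycle-free if each $\Gamma_r$ has no cycles, and homogeneous if all $|E(\Gamma_r)|$ are equal. $\mathcal{P}^{h,cf}_d(K_{2d})$ is the set of homogeneous cycle-free edge $d$-partitions of the complete graph $K_{2d}$ on vertices $1,\dots,2d$. It is a known fact that for $\Gamma\in\mathcal{P}^{h,cf}_d(K_{2d})$ and $1\le x<y<z\le 2d$ there is a unique element of $\mathcal{P}^{h,cf}_d(K_{2d})$, different from $\Gamma$, which agrees with $\Gamma$ on all edges except those of the triangle $(x,y,z)$; it is denoted $\Gamma^{(x,y,z)}$. For an edge $d$-partition $\Gamma=(\Gamma_1,\dots,\Gamma_d)$ of $K_{2d}$ set $$M_\Gamma(\otimes_{1\le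 i<j\le 2d}(v_{i,j}))=\prod_{r=1}^d\ \prod_{(i,j)\in E(\Gamma_r)}v_{i,j}^r.$$ The element $E^{(2)}_d$: let $S_a=\{2a-1,2a\}$ for $1\le a\le d$. For $1\le i<j\le 2d$ let $ind(i,j)=a$ if $i+j$ is even and $i\in S_a$, and $ind(i,j)=b$ if $i+j$ is odd and $j\in S_b$. Put $e_{i,j}=e_{ind(i,j)}$ and $E^{(2)}_d=\otimes_{1\le i<j\le 2d}(e_{i,j})$. The edge $d$-partition $\Gamma^{E^{(2)}_d}$ associated with $E^{(2)}_d$ has $r$-th subgraph with edge set $\{(i,j): ind(i,j)=r\}$; it belongs to $\mathcal{P}^{h,cf}_d(K_{2d})$. $S^2$-diagonal: $DI[2]=\{(i,j,ind(i,j)):1\le i<j\le 2d\}$; the $S^2$-diagonal $diag^{S^2}(A)$ consists of the entries of $A$ in column $(i,j)$ and row $r$ with $(i,j,r)\in DI[2]$, and $prod(diag^{S^2}(A))=\prod_{1\le i<j\le 2d}v_{i,j}^{ind(i,j)}$ is their product (one factor for each $(i,j)$). $A$ is $S^2$-Upper Triangular if for every $1\le i<j\le 2d$ the column $v_{i,j}$ lies in the span of $e_1,\dots,e_{ind(i,j)}$. *)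

(* Defs.v *)
From HB Require Import structures.
From mathcomp Require Import all_boot all_order all_algebra.
From mathcomp Require Import zify.
Set Implicit Arguments.
Unset Strict Implicit.
Unset Printing Implicit Defensive.
Import GRing.Theory.

(** All indices are shifted to start at 0: the vertices [1, ..., 2d] of
    [K_{2d}] are ['I_(2 * d)] and the rows / subgraph labels [1, ..., d] are
    ['I_d].  The shift preserves the order and the parity of [i + j], and it
    turns [S_a = {2a-1, 2a}] into [{2a, 2a+1}]. *)

Definition vertex (d : nat) := 'I_(2 * d).

Definition edge (d : nat) := {p : vertex d * vertex d | p.1 < p.2}.

Definition Edge d (i j : vertex d) (hij : i < j) : edge d :=
  exist (fun p : vertex d * vertex d => p.1 < p.2) (i, j) hij.

Definition src d (e : edge d) : vertex d := (val e).1.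
Definition tgt d (e : edge d) : vertex d := (val e).2.

Lemma src_lt_tgt d (e : edge d) : src e < tgt e.
Proof. exact: (valP e). Qed.

Lemma edge_inj d (e f : edge d) : src e = src f -> tgt e = tgt f -> e = f.
Proof.
move=> h1 h2; apply: val_inj; move: h1 h2; rewrite /src /tgt.
by case: (val e) (val f) => [a b] [a' b'] /= -> ->.
Qed.

Lemma card_edge d : #|{: edge d}| = d * (2 * d - 1).
Proof.
have -> : d * (2 * d - 1) = 'C(2 * d, 2).
  by rewrite bin2 -mulnA [in RHS]mul2n doubleK subn1.
rewrite card_sig -bin2_sum big_mkord.
rewrite -sum1_card (eq_bigl (fun p : vertex d * vertex d => true && (p.1 < p.2))) //.
rewrite -(pair_big_dep xpredT (fun i j : vertex d => i < j) (fun _ _ => 1)) /=.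
rewrite (exchange_big_dep xpredT) //=; apply: eq_bigr => j _.
rewrite sum1_card -[RHS]card_ord.
have hj : j <= 2 * d by apply: ltnW.
rewrite -(card_image (f := widen_ord hj)); last first.
  by move=> a b /(congr1 val) /= h; apply: val_inj.
apply: eq_card => i; apply/idP/imageP => [hi | [a _ ->]].
  by exists (Ordinal (hi : i < j)) => //; apply: val_inj.
exact: (ltn_ord a).
Qed.

Definition edge_lex d (f e : edge d) : bool :=
  (src f < src e) || (src f == src e) && (tgt f < tgt e).

Lemma edge_col_subproof d (e : edge d) :
  #|[set f | edge_lex f e]| < d * (2 * d - 1).
Proof.
rewrite -card_edge -cardsT; apply: proper_card; apply/properP; split.
  exact: subsetT.
by exists e => //; rewrite inE /edge_lex !ltnn andbF.
Qed.

(** Position of the pair [e] in the dictionary order. *)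
Definition edge_col d (e : edge d) : 'I_(d * (2 * d - 1)) :=
  Ordinal (edge_col_subproof e).

Lemma edge_col_inj d : injective (@edge_col d).
Proof.
have lt_col (e f : edge d) : edge_lex e f -> edge_col e < edge_col f.
  move=> hef; apply: proper_card; apply/properP; split.
    apply/subsetP => g; rewrite !inE; move: hef; rewrite /edge_lex -!val_eqE /=; lia.
  by exists e; rewrite inE // /edge_lex !ltnn andbF.
move=> e f hef; have hn : edge_col e = edge_col f :> nat by rewrite hef.
have := @lt_col e f; have := @lt_col f e; rewrite hn ltnn /edge_lex -!val_eqE /=.
by move=> h1 h2; apply: edge_inj; apply: val_inj => /=; lia.
Qed.

(** The subgraphs have all the vertices, so they are given by their edges. *)
Definition subgraphs (d : nat) := {ffun 'I_d -> {set edge d}}.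

Definition edge_partition d (G : subgraphs d) : bool :=
  [forall r, forall s, (r != s) ==> [disjoint G r & G s]]
  && (\bigcup_r G r == [set: edge d]).

Definition adj d (S : {set edge d}) : rel (vertex d) :=
  fun x y => [exists e in S, (val e == (x, y)) || (val e == (y, x))].

(** Cycles are duplicate-free, so their length is bounded by the number of
    vertices; this only serves to make the predicate boolean. *)
Definition acyclic d (S : {set edge d}) : bool :=
  [forall n : 'I_(2 * d).+1, forall c : n.-tuple (vertex d),
     ~~ [&& 2 < n, uniq c & cycle (adj S) c]].

Lemma acyclicP d (S : {set edge d}) :
  reflect (forall c : seq (vertex d), 2 < size c -> uniq c -> ~ cycle (adj S) c)
          (acyclic S).
Proof.
apply: (iffP forallP) => [h c hc uc cc | h n].
  have hn : size c < (2 * d).+1.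
    by rewrite ltnS -[X in _ <= X]card_ord -(card_uniqP uc) max_card.
  have /forallP /(_ (in_tuple c)) := h (Ordinal hn).
  by rewrite /= hc uc cc.
apply/forallP => c; apply/negP => /and3P[hn uc cc].
by apply: (h c) => //; rewrite size_tuple.
Qed.

Definition cycle_free d (G : subgraphs d) : bool := [forall r, acyclic (G r)].

Definition homogeneous d (G : subgraphs d) : bool :=
  [forall r, forall s, #|G r| == #|G s|].

(** [P^{h,cf}_d(K_{2d})] *)
Definition hcf_partition (d : nat) :=
  {G : subgraphs d | [&& edge_partition G, homogeneous G & cycle_free G]}.

Definition triangle d (x y z : vertex d) : {set edge d} :=
  [set e | val e \in [:: (x, y); (x, z); (y, z)]].

(** [H] is [G^{(x,y,z)}]: for [x < y < z] there is exactly one such [H]. *)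
Definition is_flip d (x y z : vertex d) (G H : hcf_partition d) : Prop :=
  H != G /\
  forall (e : edge d) (r : 'I_d),
    e \notin triangle x y z -> (e \in val H r) = (e \in val G r).

Definition Sblock d (a : 'I_d) : {set vertex d} :=
  [set i : vertex d | (val i == 2 * a) || (val i == (2 * a).+1)].

Lemma block_subproof d (i : vertex d) : i./2 < d.
Proof. have := ltn_ord i; lia. Qed.

Definition block d (i : vertex d) : 'I_d := Ordinal (block_subproof i).

Lemma blockP d (i : vertex d) (a : 'I_d) : (block i == a) = (i \in Sblock a).
Proof. rewrite inE -val_eqE /=; lia. Qed.

Definition ind d (e : edge d) : 'I_d :=
  if odd (src e + tgt e) then block (tgt e) else block (src e).

Definition E2_subgraphs d : subgraphs d := [ffun r => [set e | ind e == r]].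

Lemma E2_edge_partition d : edge_partition (E2_subgraphs d).
Proof.
apply/andP; split.
  apply/forallP => r; apply/forallP => s; apply/implyP => hrs.
  rewrite -setI_eq0; apply/eqP/setP => e; rewrite !ffunE !inE.
  by apply/negP => /andP[/eqP -> /eqP h]; rewrite h eqxx in hrs.
apply/eqP/setP => e; rewrite inE; apply/bigcupP.
by exists (ind e); rewrite // ffunE inE.
Qed.

Lemma E2_card_le d (a : 'I_d) : #|E2_subgraphs d a| <= 2 * d - 1.
Proof.
have ha : 2 * a < 2 * d by have := ltn_ord a; lia.
pose root : vertex d := Ordinal ha.
pose child (e : edge d) := if odd (src e + tgt e) && (src e != root) then src e else tgt e.
have -> : 2 * d - 1 = #|[set~ root]| by rewrite cardsC1 card_ord; lia.
rewrite -(@card_in_imset _ _ child).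
  apply/subset_leq_card/subsetP => _ /imsetP[e + ->].
  have := src_lt_tgt e.
  rewrite ffunE !inE /ind /child -!val_eqE /= => hlt.
  by do !case: ifP => /=; lia.
move=> e f; have := src_lt_tgt e; have := src_lt_tgt f.
rewrite !ffunE !inE /ind /child -!val_eqE /= => hf he.
move=> h1 h2 /(congr1 val) h3.
have [hs ht] : val (src e) = val (src f) /\ val (tgt e) = val (tgt f).
  by move: h1 h2 h3; do !case: ifP => /=; lia.
by apply: edge_inj; apply: val_inj.
Qed.

Lemma E2_card d (a : 'I_d) : #|E2_subgraphs d a| = 2 * d - 1.
Proof.
have htot : \sum_(r < d) #|E2_subgraphs d r| = d * (2 * d - 1).
  rewrite -card_edge -sum1_card.
  rewrite [RHS](partition_big (@ind d) xpredT) //=.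
  apply: eq_bigr => r _; rewrite sum1_card; apply: eq_card => e.
  by rewrite ffunE inE.
have hle : \sum_(r < d | r != a) #|E2_subgraphs d r| <= d.-1 * (2 * d - 1).
  apply: (@leq_trans (\sum_(r < d | r != a) (2 * d - 1))).
    by apply: leq_sum => r _; apply: E2_card_le.
  by rewrite sum_nat_const cardC1 card_ord.
have hmul : d * (2 * d - 1) = (2 * d - 1) + d.-1 * (2 * d - 1).
  by rewrite -mulSn prednK //; apply: leq_ltn_trans (ltn_ord a).
apply/eqP; rewrite eqn_leq E2_card_le /=.
rewrite -(leq_add2r (d.-1 * (2 * d - 1))) -hmul -htot (bigD1 a) //=.
by rewrite leq_add2l.
Qed.

Lemma E2_adj d (a : 'I_d) (x y : vertex d) : x \notin Sblock a ->
  adj (E2_subgraphs d a) x y -> val y = 2 * a + (odd x (+) (x < 2 * a)).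
Proof.
move=> hx /existsP[[[i j] /= hij] /andP[he]].
move: hx he; rewrite !xpair_eqE ffunE !inE /ind /src /tgt -!val_eqE /=.
by move=> hx; case: ifP => /=; lia.
Qed.

Lemma adj_sym d (S : {set edge d}) : symmetric (adj S).
Proof. by move=> x y; apply: eq_existsb => e; rewrite orbC. Qed.

Lemma E2_cycle_free d : cycle_free (E2_subgraphs d).
Proof.
apply/forallP => a; apply/acyclicP => c hc uc cc.
have hS x : x \in c -> x \in Sblock a.
  move=> hxc; apply/negP => /negP hx.
  have [i p hp] := rot_to hxc.
  have : cycle (adj (E2_subgraphs d a)) (x :: p) by rewrite -hp rot_cycle.
  have : uniq (x :: p) by rewrite -hp rot_uniq.
  have : 2 < size (x :: p) by rewrite -hp size_rot.
  case: p {hp} => [|y [|z q]] //= _ /and3P[_ hy _].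
  rewrite rcons_path => /and4P[h1 _ _ h2].
  rewrite adj_sym in h2.
  have hE : y = last z q.
    by apply: val_inj; rewrite (E2_adj hx h1) (E2_adj hx h2).
  by rewrite hE mem_last in hy.
have hsub : {subset map val c <= [:: 2 * a; (2 * a).+1]}.
  by move=> _ /mapP[x /hS hx ->]; move: hx; rewrite !inE.
have : size (map val c) <= 2.
  by apply: (uniq_leq_size (s2 := [:: 2 * a; (2 * a).+1]) _ hsub); rewrite map_inj_uniq //; apply: val_inj.
by rewrite size_map leqNgt hc.
Qed.

Lemma E2_hcf d :
  [&& edge_partition (E2_subgraphs d), homogeneous (E2_subgraphs d)
    & cycle_free (E2_subgraphs d)].
Proof.
rewrite E2_edge_partition E2_cycle_free andbT /=.
by apply/forallP => r; apply/forallP => s; rewrite !E2_card.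
Qed.

Definition E2_partition d : hcf_partition d := exist _ (E2_subgraphs d) (E2_hcf d).

Local Open Scope ring_scope.

Section Tensors.
Variables (k : fieldType) (d : nat).

Definition ebase (r : 'I_d) : 'cV[k]_d := delta_mx r 0.

(** [V_d^{\otimes d(2d-1)}] in coordinates: the value of a tensor at [phi] is
    its coefficient on the basis vector [\otimes_(i < j) e_(phi (i, j))]. *)
Definition tensor := {ffun {ffun edge d -> 'I_d} -> k^o}.

Definition simple_tensor (v : edge d -> 'cV[k]_d) : tensor :=
  [ffun phi : {ffun edge d -> 'I_d} => \prod_(e : edge d) v e (phi e) 0].

Lemma simple_tensor_ebase (phi psi : {ffun edge d -> 'I_d}) :
  simple_tensor (fun e => ebase (phi e)) psi = (psi == phi)%:R.
Proof.
rewrite ffunE; have [-> | hne] := eqVneq psi phi.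
  by rewrite big1 // => e _; rewrite mxE !eqxx.
have [e he] : exists e, psi e != phi e.
  by apply/existsP; rewrite -negb_forall; apply: contra hne => /forallP h;
     apply/eqP/ffunP => e; apply/eqP; apply: h.
by rewrite (bigD1 e) //= mxE (negbTE he) mul0r.
Qed.

Definition E2_tensor : tensor := simple_tensor (fun e => ebase (ind e)).

Definition M_Gamma (G : hcf_partition d) (v : edge d -> 'cV[k]_d) : k :=
  \prod_(r < d) \prod_(e in val G r) v e r 0.

Definition column (A : 'M[k]_(d, d * (2 * d - 1))) (e : edge d) : 'cV[k]_d :=
  col (edge_col e) A.

Definition tensor_of_mx (A : 'M[k]_(d, d * (2 * d - 1))) : tensor :=
  simple_tensor (column A).

Definition prod_diagS2 (A : 'M[k]_(d, d * (2 * d - 1))) : k :=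
  \prod_(e : edge d) column A e (ind e) 0.

Definition S2_upper_triangular (A : 'M[k]_(d, d * (2 * d - 1))) : Prop :=
  forall e : edge d,
    column A e \in <<[seq ebase r | r : 'I_d <- enum 'I_d & (r <= ind e)%N]>>%VS.

End Tensors.

Arguments E2_tensor : clear implicits.

(* Main.v *)
Require Import Defs.
From mathcomp Require Import all_boot all_order all_algebra.
Set Implicit Arguments.
Unset Strict Implicit.
Unset Printing Implicit Defensive.
Import GRing.Theory.
Local Open Scope ring_scope.

(** Let a partition [G] in [P^{h,cf}_d(K_{2d})] contribute to the determinant of
    an upper triangular [A].  Then every edge [e] of the [r]-th subgraph of [G]
    has a nonzero entry in row [r], so that [r <= ind e].  Compare the sums over
    all edges of both sides.  The right-hand side adds up the labels of the
    edges in the partition associated with [E^(2)], the left-hand side their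
    labels in [G]; in both partitions each label [r] is carried by exactly
    [2d - 1] edges, so the two totals agree.  Hence all the inequalities
    [r <= ind e] are equalities, and [G] is the partition associated with
    [E^(2)] ([dominated_hcf_eq_E2]).

    The determinant of an upper triangular family thus reduces to a single term,
    the sign of the [E^(2)] partition times the product of the diagonal
    ([sum_upper_triangular]).  The columns of [E^(2)] itself form such a family,
    with diagonal entries [1], which identifies that sign with [det E^(2)]. *)

Lemma big_edge_partition (R : Type) (idx : R) (op : Monoid.com_law idx)
    (d : nat) (G : hcf_partition d) (F : edge d -> R) :
  \big[op/idx]_e F e = \big[op/idx]_r \big[op/idx]_(e in val G r) F e.
Proof.
have /and3P[/andP[/forallP disjG /eqP coverG] _ _] := valP G.
rewrite -partition_disjoint_bigcup; last first.
  by move=> r s rs; have /forallP/(_ s)/implyP := disjG r; apply.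
by rewrite coverG; apply: eq_bigl => e; rewrite inE.
Qed.

Lemma card_hcf (d : nat) (G : hcf_partition d) (r : 'I_d) :
  #|val G r| = (2 * d - 1)%N.
Proof.
have /and3P[_ /forallP homG _] := valP G.
have d_gt0 : (0 < d)%N by apply: leq_ltn_trans (ltn_ord r).
apply/eqP; rewrite -(eqn_pmul2l d_gt0) -card_edge -[X in _ == X]sum1_card.
rewrite (big_edge_partition _ G) -[X in (X * _)%N]card_ord -sum_nat_const.
by apply/eqP/eq_bigr => s _; rewrite sum1_card; apply/eqP/(forallP (homG r)).
Qed.

Lemma sum_labels_hcf (d : nat) (G : hcf_partition d) :
  (\sum_(r < d) \sum_(e in val G r) r = \sum_(r < d) (2 * d - 1) * r)%N.
Proof. by apply: eq_bigr => r _; rewrite sum_nat_const card_hcf. Qed.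

Lemma mem_E2 (d : nat) (r : 'I_d) (e : edge d) :
  (e \in val (E2_partition d) r) = (ind e == r).
Proof. by rewrite ffunE inE. Qed.

(** Both partitions have the same total of labels, so a pointwise inequality
    between labels leaves no slack. *)
Lemma dominated_hcf_eq_E2 (d : nat) (G : hcf_partition d) :
  (forall (r : 'I_d) (e : edge d), e \in val G r -> (r <= ind e)%N) ->
  G = E2_partition d.
Proof.
move=> leG.
have sum_ind : (\sum_(r < d) \sum_(e in val G r) ind e
                = \sum_(r < d) \sum_(e in val G r) r)%N.
  rewrite -big_edge_partition (big_edge_partition _ (E2_partition d)).
  rewrite sum_labels_hcf -(sum_labels_hcf (E2_partition d)).
  by apply: eq_bigr => r _; apply: eq_bigr => e; rewrite mem_E2 => /eqP ->.
have indG (r : 'I_d) (e : edge d) : e \in val G r -> ind e = r.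
  have le_row (s : 'I_d) : true ->
      (\sum_(f in val G s) s <= \sum_(f in val G s) ind f
        ?= iff [forall (f | f \in val G s), val s == ind f])%N.
    by move=> _; apply: leqif_sum => f fG; split=> //; apply: leG.
  have [_] := leqif_sum le_row; rewrite sum_ind eqxx => /esym /forallP/(_ r).
  by move=> /forallP/(_ e)/implyP h eG; apply/val_inj/esym/eqP/h.
apply/val_inj/ffunP => r; apply/eqP; rewrite eqEcard !card_hcf leqnn andbT.
by apply/subsetP => e /indG; rewrite mem_E2 => ->.
Qed.

Lemma M_Gamma_E2 (k : fieldType) (d : nat) (v : edge d -> 'cV[k]_d) :
  M_Gamma (E2_partition d) v = \prod_e v e (ind e) 0.
Proof.
rewrite (big_edge_partition _ (E2_partition d)).
by apply: eq_bigr => r _; apply: eq_bigr => e; rewrite mem_E2 => /eqP ->.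
Qed.

Lemma M_Gamma_upper_triangular (k : fieldType) (d : nat)
    (v : edge d -> 'cV[k]_d) (G : hcf_partition d) :
  (forall (e : edge d) (r : 'I_d), (ind e < r)%N -> v e r 0 = 0) ->
  G != E2_partition d -> M_Gamma G v = 0.
Proof.
move=> v_up; apply: contraNeq => MG_neq0; apply/eqP/dominated_hcf_eq_E2 => r e eG.
rewrite leqNgt; apply: contra MG_neq0 => /v_up ve0.
by rewrite /M_Gamma (bigD1 r) //= (bigD1 e) //= ve0 !mul0r.
Qed.

Lemma sum_upper_triangular (k : fieldType) (d : nat)
    (eps : hcf_partition d -> int) (v : edge d -> 'cV[k]_d) :
  (forall (e : edge d) (r : 'I_d), (ind e < r)%N -> v e r 0 = 0) ->
  \sum_(G : hcf_partition d) (eps G)%:~R * M_Gamma G v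
  = (eps (E2_partition d))%:~R * \prod_e v e (ind e) 0.
Proof.
move=> v_up; rewrite (bigD1 (E2_partition d)) //= M_Gamma_E2 [X in _ + X]big1 ?addr0 //.
by move=> G GE2; rewrite M_Gamma_upper_triangular ?mulr0.
Qed.

Lemma span_ebase_eq0 (k : fieldType) (d : nat) (P : pred 'I_d) (u : 'cV[k]_d)
    (r : 'I_d) :
  u \in <<[seq ebase k s | s : 'I_d <- enum 'I_d & P s]>>%VS ->
  ~~ P r -> u r 0 = 0.
Proof.
set X := map _ _ => uX Pr.
rewrite (coord_span (X := in_tuple X) uX) summxE big1 // => i _.
have /mapP[s sP ->] : X`_i \in X by apply: mem_nth.
rewrite !mxE; case: eqP sP => [<- | _ _]; last by rewrite mulr0.
by rewrite mem_filter (negPf Pr).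
Qed.

Theorem theorem3p12 (k : fieldType) (d : nat)
    (char_neq2 : 2%N \notin [pchar k]) (char_neq3 : 3%N \notin [pchar k])
    (d_gt1 : (1 < d)%N)
    (* the sign map of statement (1) *)
    (eps : hcf_partition d -> int)
    (eps_sign : forall G : hcf_partition d, eps G = 1 \/ eps G = -1)
    (eps_E2 : eps (E2_partition d) = (-1) ^+ d.+1)
    (eps_flip : forall (G H : hcf_partition d) (x y z : vertex d),
        (x < y)%N -> (y < z)%N -> is_flip x y z G H -> eps H = - eps G)
    (* the map of statement (2) *)
    (det : tensor k d -> k)
    (det_simple : forall v : edge d -> 'cV[k]_d,
        det (simple_tensor v) = \sum_(G : hcf_partition d) (eps G)%:~R * M_Gamma G v)
    (det_linear : scalar det)
    (det_nontrivial : exists t : tensor k d, det t != 0)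
    (det_vanish : forall (v : edge d -> 'cV[k]_d) (x y z : vertex d)
        (hxy : (x < y)%N) (hyz : (y < z)%N),
        v (Edge hxy) = v (Edge (ltn_trans hxy hyz)) ->
        v (Edge (ltn_trans hxy hyz)) = v (Edge hyz) ->
        det (simple_tensor v) = 0)
    (A : 'M[k]_(d, d * (2 * d - 1)))
    (A_triangular : S2_upper_triangular A) :
  det (tensor_of_mx A) = det (E2_tensor k d) * prod_diagS2 A.
Proof.
have A_up (e : edge d) (r : 'I_d) : (ind e < r)%N -> column A e r 0 = 0.
  by move=> lt_r; apply: span_ebase_eq0 (A_triangular e) _; rewrite -ltnNge.
have E2_up (e : edge d) (r : 'I_d) : (ind e < r)%N -> ebase k (ind e) r 0 = 0.
  by move=> lt_r; rewrite mxE -val_eqE /= gtn_eqF.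
rewrite /tensor_of_mx /E2_tensor !det_simple.
rewrite (sum_upper_triangular _ A_up) (sum_upper_triangular _ E2_up).
by rewrite [X in _ * X * _]big1 ?mulr1 // => e _; rewrite mxE !eqxx.
Qed.
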